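(* Let $L$ be a weakly dicomplemented lattice. (1) If $M$ is a subalgebra of $L$, then the lattice $NF(M)$ of normal filters of $M$ embeds in the lattice $NF(L)$ of normal filters of $L$. (2) If every normal chain in $L$ is finite, then $NF(L)$ and $F(B(L))$ are isomorphic lattices.
   Context: A weakly dicomplemented lattice (WDL) is an algebra $(L;\wedge,\vee,{}^{\Delta},{}^{\nabla},0,1)$ of type $(2,2,1,1,0,0)$ such that $(L;\wedge,\vee,0,1)$ is a bounded lattice and for all $x,y\in L$: $x^{\Delta\Delta}\le x$; $x\le y\Rightarrow y^{\Delta}\le x^{\Delta}$; $(x\wedge y)\vee(x\wedge y^{\Delta})=x$; $x^{\nabla\nabla}\ge x$; $x\le y\Rightarrow y^{\nabla}\le x^{\nabla}$; $(x\vee y)\wedge(x\vee y^{\nabla})=x$. Exponents are applied from left to right: $x^{\Delta\nabla}=(x^{\Delta})^{\nabla}$. Subalgebras are closed under all operations, including the constants $0,1$. A filter is a nonempty upward closed subset closed under $\wedge$ (the whole lattice is allowed). A filter $F$ is normal if $x\in F$ implies $x^{\Delta\nabla}\in F$. $NF(L)$ is the lattice of normal filters of $L$ ordered by inclusion. The Boolean center of $L$ is $B(L)=\{x\in L\mid x^{\Delta}=x^{\nabla}\}$; it is a subalgebra of $L$ and a Boolean algebra with complementation $x'=x^{\Delta}=x^{\nabla}$; $F(B(L))$ is the lattice of filters of $B(L)$ ordered by inclusion. For $a\in L$ put $a^{1(\Delta\nabla)}=a^{\Delta\nabla}$ and $a^{(k+1)(\Delta\nabla)}=(a^{k(\Delta\nabla)})^{\Delta\nabla}$.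 The chain $a\ge a^{1(\Delta\nabla)}\ge a^{2(\Delta\nabla)}\ge\cdots$ is the normal chain determined by $a$; it is finite if there is $n\ge1$ with $a^{(n+1)(\Delta\nabla)}=a^{n(\Delta\nabla)}$. *)

(* Defs.v *)
From HB Require Import structures.
From mathcomp Require Import all_boot all_order.
From mathcomp Require Import boolp classical_sets.

Set Implicit Arguments.
Unset Strict Implicit.
Unset Printing Implicit Defensive.

Import Order.TTheory.
Local Open Scope classical_set_scope.
Local Open Scope order_scope.

Reserved Notation "x ^Δ" (at level 1, left associativity, format "x ^Δ").
Reserved Notation "x ^∇" (at level 1, left associativity, format "x ^∇").

HB.mixin Record isWDL d L of Order.TBLattice d L := {
  wdelta : L -> L;
  wnabla : L -> L;
  wdeltaK_le : forall x : L, wdelta (wdelta x) <= x;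
  wdelta_anti : forall x y : L, x <= y -> wdelta y <= wdelta x;
  wdelta_split : forall x y : L, (x `&` y) `|` (x `&` wdelta y) = x;
  wnablaK_ge : forall x : L, x <= wnabla (wnabla x);
  wnabla_anti : forall x y : L, x <= y -> wnabla y <= wnabla x;
  wnabla_split : forall x y : L, (x `|` y) `&` (x `|` wnabla y) = x
}.

(* Weakly dicomplemented lattices. The trivial one (\bot = \top) is allowed. *)
#[short(type="wdlType")]
HB.structure Definition WDL d := { L of Order.TBLattice d L & isWDL d L }.

Notation "x ^Δ" := (wdelta x) : order_scope.
Notation "x ^∇" := (wnabla x) : order_scope.

Section WDLTheory.
Context {d : Order.disp_t} {L : wdlType d}.
Implicit Types x y : L.

Lemma joinxD x : x `|` x^Δ = \top.
Proof. by have := wdelta_split (\top : L) x; rewrite !meet1x. Qed.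

Lemma meetxN x : x `&` x^∇ = \bot.
Proof. by have := wnabla_split (\bot : L) x; rewrite !join0x. Qed.

Lemma wdelta0 : (\bot : L)^Δ = \top.
Proof. by rewrite -[LHS]join0x joinxD. Qed.

Lemma wnabla1 : (\top : L)^∇ = \bot.
Proof. by rewrite -[LHS]meet1x meetxN. Qed.

Lemma wdelta1 : (\top : L)^Δ = \bot.
Proof. by apply/eqP; rewrite -lex0 -wdelta0 wdeltaK_le. Qed.

Lemma wnabla0 : (\bot : L)^∇ = \top.
Proof. by apply/eqP; rewrite -le1x -wnabla1 wnablaK_ge. Qed.

Lemma wnabla_le_wdelta x : x^∇ <= x^Δ.
Proof.
by rewrite -(wdelta_split x^∇ x) [_ `&` x]meetC meetxN join0x leIr.
Qed.

Lemma wdeltaI x y : (x `&` y)^Δ = x^Δ `|` y^Δ.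
Proof.
apply/le_anti/andP; split; last first.
  by rewrite leUx !wdelta_anti ?leIl ?leIr.
set z := x^Δ `|` y^Δ.
have zxy : z^Δ <= x `&` y.
  rewrite lexI; apply/andP; split.
    by apply: (le_trans _ (wdeltaK_le x)); apply/wdelta_anti/leUl.
  by apply: (le_trans _ (wdeltaK_le y)); apply/wdelta_anti/leUr.
exact: (le_trans (wdelta_anti _ _ zxy) (wdeltaK_le z)).
Qed.

Lemma wnablaU x y : (x `|` y)^∇ = x^∇ `&` y^∇.
Proof.
apply/le_anti/andP; split.
  by rewrite lexI !wnabla_anti ?leUl ?leUr.
set z := x^∇ `&` y^∇.
have zxy : x `|` y <= z^∇.
  rewrite leUx; apply/andP; split.
    by apply: (le_trans (wnablaK_ge x)); apply/wnabla_anti/leIl.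
  by apply: (le_trans (wnablaK_ge y)); apply/wnabla_anti/leIr.
exact: (le_trans (wnablaK_ge z) (wnabla_anti _ _ zxy)).
Qed.

End WDLTheory.

Record subalgebra d (L : wdlType d) := Subalgebra {
  subalg_set : set L;
  subalg0 : subalg_set \bot;
  subalg1 : subalg_set \top;
  subalgI : forall x y : L,
    subalg_set x -> subalg_set y -> subalg_set (x `&` y);
  subalgU : forall x y : L,
    subalg_set x -> subalg_set y -> subalg_set (x `|` y);
  subalgD : forall x : L, subalg_set x -> subalg_set x^Δ;
  subalgN : forall x : L, subalg_set x -> subalg_set x^∇
}.

Definition subalg_type d (L : wdlType d) (M : subalgebra L) : Type :=
  {x : L | x \in subalg_set M}.

(* A subalgebra, used as a type, is itself a weakly dicomplemented lattice for
   the operations restricted from L. *)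
Coercion subalg_type : subalgebra >-> Sortclass.

Section SubalgebraWDL.
Context {d : Order.disp_t} {L : wdlType d} (M : subalgebra L).

HB.instance Definition _ := SubType.on (subalg_type M).
HB.instance Definition _ := Choice.on (subalg_type M).

Fact subalg_meet_closed : {in subalg_set M &, forall x y : L,
  x `&` y \in subalg_set M}.
Proof. by move=> x y /set_mem Mx /set_mem My; apply/mem_set/subalgI. Qed.

Fact subalg_join_closed : {in subalg_set M &, forall x y : L,
  x `|` y \in subalg_set M}.
Proof. by move=> x y /set_mem Mx /set_mem My; apply/mem_set/subalgU. Qed.

Fact subalg_bot_closed : \bot \in subalg_set M.
Proof. exact/mem_set/subalg0. Qed.

Fact subalg_top_closed : \top \in subalg_set M.
Proof. exact/mem_set/subalg1. Qed.

HB.instance Definition _ := Order.SubChoice_isTBSubLattice.Build d L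
  (fun x => x \in subalg_set M) d (subalg_type M)
  subalg_meet_closed subalg_join_closed subalg_bot_closed subalg_top_closed.

Implicit Types x y : subalg_type M.

Lemma subalg_leE x y : (x <= y) = (val x <= val y).
Proof. by []. Qed.

Lemma subalg_meetE x y : val (x `&` y) = val x `&` val y.
Proof. by []. Qed.

Lemma subalg_joinE x y : val (x `|` y) = val x `|` val y.
Proof. by []. Qed.

Fact subalg_delta_closed x : (val x)^Δ \in subalg_set M.
Proof. exact/mem_set/subalgD/set_mem/valP. Qed.

Fact subalg_nabla_closed x : (val x)^∇ \in subalg_set M.
Proof. exact/mem_set/subalgN/set_mem/valP. Qed.

Definition subalg_delta x : subalg_type M :=
  exist (fun z => z \in subalg_set M) _ (subalg_delta_closed x).
Definition subalg_nabla x : subalg_type M :=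
  exist (fun z => z \in subalg_set M) _ (subalg_nabla_closed x).

Lemma subalg_deltaE x : val (subalg_delta x) = (val x)^Δ.
Proof. by []. Qed.

Lemma subalg_nablaE x : val (subalg_nabla x) = (val x)^∇.
Proof. by []. Qed.

Fact subalg_deltaK_le x : subalg_delta (subalg_delta x) <= x.
Proof. by rewrite subalg_leE wdeltaK_le. Qed.

Fact subalg_delta_anti x y : x <= y -> subalg_delta y <= subalg_delta x.
Proof. by rewrite !subalg_leE; exact: wdelta_anti. Qed.

Fact subalg_delta_split x y : (x `&` y) `|` (x `&` subalg_delta y) = x.
Proof.
by apply: val_inj; rewrite subalg_joinE !subalg_meetE wdelta_split.
Qed.

Fact subalg_nablaK_ge x : x <= subalg_nabla (subalg_nabla x).
Proof. by rewrite subalg_leE wnablaK_ge. Qed.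

Fact subalg_nabla_anti x y : x <= y -> subalg_nabla y <= subalg_nabla x.
Proof. by rewrite !subalg_leE; exact: wnabla_anti. Qed.

Fact subalg_nabla_split x y : (x `|` y) `&` (x `|` subalg_nabla y) = x.
Proof.
by apply: val_inj; rewrite subalg_meetE !subalg_joinE wnabla_split.
Qed.

HB.instance Definition _ := isWDL.Build d (subalg_type M)
  subalg_deltaK_le subalg_delta_anti subalg_delta_split
  subalg_nablaK_ge subalg_nabla_anti subalg_nabla_split.

End SubalgebraWDL.

Section BooleanCenter.
Context {d : Order.disp_t} (L : wdlType d).

Definition boolean_center_set : set L := [set x | x^Δ = x^∇].

Fact boolean_center0 : boolean_center_set \bot.
Proof. by rewrite /boolean_center_set /= wdelta0 wnabla0. Qed.

Fact boolean_center1 : boolean_center_set \top.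
Proof. by rewrite /boolean_center_set /= wdelta1 wnabla1. Qed.

Fact boolean_centerI x y : boolean_center_set x -> boolean_center_set y ->
  boolean_center_set (x `&` y).
Proof.
rewrite /boolean_center_set /= => ex ey.
apply/le_anti/andP; split; last exact: wnabla_le_wdelta.
by rewrite wdeltaI ex ey leUx !wnabla_anti ?leIl ?leIr.
Qed.

Fact boolean_centerU x y : boolean_center_set x -> boolean_center_set y ->
  boolean_center_set (x `|` y).
Proof.
rewrite /boolean_center_set /= => ex ey.
apply/le_anti/andP; split; last exact: wnabla_le_wdelta.
by rewrite wnablaU -ex -ey lexI !wdelta_anti ?leUl ?leUr.
Qed.

Fact boolean_centerD x : boolean_center_set x -> boolean_center_set x^Δ.
Proof.
rewrite /boolean_center_set /= => ex.
apply/le_anti/andP; split; last exact: wnabla_le_wdelta.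
by rewrite [in leRHS]ex (le_trans (wdeltaK_le x)) ?wnablaK_ge.
Qed.

Fact boolean_centerN x : boolean_center_set x -> boolean_center_set x^∇.
Proof. by move=> Bx; rewrite -[x^∇]Bx; apply: boolean_centerD. Qed.

Definition boolean_center : subalgebra L :=
  Subalgebra boolean_center0 boolean_center1 boolean_centerI boolean_centerU
    boolean_centerD boolean_centerN.

End BooleanCenter.

Definition is_filter d (L : tbLatticeType d) (F : set L) : Prop :=
  [/\ F !=set0,
      forall x y : L, F x -> x <= y -> F y &
      forall x y : L, F x -> F y -> F (x `&` y)].

Definition is_normal_filter d (L : wdlType d) (F : set L) : Prop :=
  is_filter F /\ forall x : L, F x -> F x^Δ^∇.

(* [lfilter L] is F(L) and [nfilter L] is NF(L); the predicates are wrapped in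
   [`[< _ >]] because subtypes are carved out by boolean predicates. *)
Record lfilter d (L : tbLatticeType d) := LFilter {
  lfilter_set : set L;
  lfilterP : `[< is_filter lfilter_set >]
}.

Record nfilter d (L : wdlType d) := NFilter {
  nfilter_set : set L;
  nfilterP : `[< is_normal_filter nfilter_set >]
}.

Lemma is_filter_top d (L : tbLatticeType d) (F : set L) :
  is_filter F -> F \top.
Proof. by move=> [[x Fx] up _]; apply: up Fx (lex1 x). Qed.

Lemma is_filter_bigcap d (L : tbLatticeType d) (P : set (set L)) :
  (forall F, P F -> is_filter F) -> is_filter (\bigcap_(F in P) F).
Proof.
move=> Pf; split.
- by exists \top => F PF; exact: (is_filter_top (Pf F PF)).
- by move=> x y Fx xy F PF; have [_ up _] := Pf F PF; exact: (up x y (Fx F PF) xy).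
- move=> x y Fx Fy F PF; have [_ _ cl] := Pf F PF.
  by apply: cl; [apply: Fx|apply: Fy].
Qed.

Lemma is_normal_filter_bigcap d (L : wdlType d) (P : set (set L)) :
  (forall F, P F -> is_normal_filter F) ->
  is_normal_filter (\bigcap_(F in P) F).
Proof.
move=> Pf; split; first by apply: is_filter_bigcap => F /Pf[].
by move=> x Fx F PF; have [_ nF] := Pf F PF; exact: (nF x (Fx F PF)).
Qed.

HB.instance Definition _ d (L : tbLatticeType d) :=
  [isSub for @lfilter_set d L].
HB.instance Definition _ d (L : tbLatticeType d) :=
  [Choice of lfilter L by <:].
HB.instance Definition _ d (L : tbLatticeType d) :=
  [SubChoice_isSubPOrder of lfilter L by <: with set_display].

HB.instance Definition _ d (L : wdlType d) := [isSub for @nfilter_set d L].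
HB.instance Definition _ d (L : wdlType d) := [Choice of nfilter L by <:].
HB.instance Definition _ d (L : wdlType d) :=
  [SubChoice_isSubPOrder of nfilter L by <: with set_display].

(* The order on (normal) filters is inclusion. Meets are intersections, and the
   join of F and G is the least (normal) filter containing F and G. *)
Section FilterLattice.
Context {d : Order.disp_t} {L : tbLatticeType d}.
Implicit Types F G H : lfilter L.

Lemma lfilter_leP F G : (F <= G) = `[< lfilter_set F `<=` lfilter_set G >].
Proof. by rewrite -Order.le_val; apply/subsetPset/asboolP. Qed.

Fact lfilter_meet_subproof F G :
  `[< is_filter (lfilter_set F `&` lfilter_set G)%classic >].
Proof.
rewrite -bigcap2E; apply/asboolP.
have -> : \bigcap_i bigcap2 (lfilter_set F) (lfilter_set G) i =
          \bigcap_(A in [set lfilter_set F; lfilter_set G]) A.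
  by rewrite bigcap2E bigcap_setU !bigcap_set1.
by apply: is_filter_bigcap => A [] ->; apply/asboolP/lfilterP.
Qed.

Definition lfilter_meet F G : lfilter L := LFilter (lfilter_meet_subproof F G).

Fact lfilter_join_subproof F G :
  `[< is_filter (\bigcap_(A in [set A | is_filter A /\
        lfilter_set F `<=` A /\ lfilter_set G `<=` A]) A) >].
Proof. by apply/asboolP/is_filter_bigcap => A []. Qed.

Definition lfilter_join F G : lfilter L := LFilter (lfilter_join_subproof F G).

Fact lfilter_lexI F G H : (F <= lfilter_meet G H) = (F <= G) && (F <= H).
Proof.
rewrite !lfilter_leP; apply/asboolP/andP => [|[/asboolP FG /asboolP FH]].
  by rewrite subsetI => -[FG FH]; split; apply/asboolP.
by rewrite subsetI.
Qed.

Fact lfilter_leUx F G H : (lfilter_join F G <= H) = (F <= H) && (G <= H).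
Proof.
rewrite !lfilter_leP; apply/asboolP/andP => [FGH|[/asboolP FH /asboolP GH]].
  by split; apply/asboolP => x xFG; apply: FGH => A [_ [FA GA]];
    [apply: FA|apply: GA].
move=> x xFG; apply: xFG; split; first exact/asboolP/lfilterP.
by split.
Qed.

HB.instance Definition _ := Order.POrder_MeetJoin_isLattice.Build
  set_display (lfilter L) lfilter_lexI lfilter_leUx.

End FilterLattice.

Section NormalFilterLattice.
Context {d : Order.disp_t} {L : wdlType d}.
Implicit Types F G H : nfilter L.

Lemma nfilter_leP F G : (F <= G) = `[< nfilter_set F `<=` nfilter_set G >].
Proof. by rewrite -Order.le_val; apply/subsetPset/asboolP. Qed.

Fact nfilter_meet_subproof F G :
  `[< is_normal_filter (nfilter_set F `&` nfilter_set G)%classic >].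
Proof.
rewrite -bigcap2E; apply/asboolP.
have -> : \bigcap_i bigcap2 (nfilter_set F) (nfilter_set G) i =
          \bigcap_(A in [set nfilter_set F; nfilter_set G]) A.
  by rewrite bigcap2E bigcap_setU !bigcap_set1.
by apply: is_normal_filter_bigcap => A [] ->; apply/asboolP/nfilterP.
Qed.

Definition nfilter_meet F G : nfilter L := NFilter (nfilter_meet_subproof F G).

Fact nfilter_join_subproof F G :
  `[< is_normal_filter (\bigcap_(A in [set A | is_normal_filter A /\
        nfilter_set F `<=` A /\ nfilter_set G `<=` A]) A) >].
Proof. by apply/asboolP/is_normal_filter_bigcap => A []. Qed.

Definition nfilter_join F G : nfilter L := NFilter (nfilter_join_subproof F G).

Fact nfilter_lexI F G H : (F <= nfilter_meet G H) = (F <= G) && (F <= H).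
Proof.
rewrite !nfilter_leP; apply/asboolP/andP => [|[/asboolP FG /asboolP FH]].
  by rewrite subsetI => -[FG FH]; split; apply/asboolP.
by rewrite subsetI.
Qed.

Fact nfilter_leUx F G H : (nfilter_join F G <= H) = (F <= H) && (G <= H).
Proof.
rewrite !nfilter_leP; apply/asboolP/andP => [FGH|[/asboolP FH /asboolP GH]].
  by split; apply/asboolP => x xFG; apply: FGH => A [_ [FA GA]];
    [apply: FA|apply: GA].
move=> x xFG; apply: xFG; split; first exact/asboolP/nfilterP.
by split.
Qed.

HB.instance Definition _ := Order.POrder_MeetJoin_isLattice.Build
  set_display (nfilter L) nfilter_lexI nfilter_leUx.

End NormalFilterLattice.

Definition normal_chain d (L : wdlType d) (a : L) (k : nat) : L :=
  iter k (fun x => x^Δ^∇) a.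

Definition finite_normal_chain d (L : wdlType d) (a : L) : Prop :=
  exists n : nat, (1 <= n)%N /\ normal_chain a n.+1 = normal_chain a n.

(* Main.v *)
From HB Require Import structures.
Require Import Defs.
From mathcomp Require Import all_boot all_order.
From mathcomp Require Import boolp classical_sets.

(** Both parts rest on one pair of maps attached to a subalgebra [M] of [L]:
    [up_closure] sends a set [F] of elements of [M] to everything in [L] that
    lies above some element of [F], and [trace] sends a set [G] of elements of
    [L] to its intersection with [M].

    The operation [x |-> x^Δ^∇] is monotone, being composed of two antitone
    ones, so [up_closure] preserves normality of filters; [trace] does because
    [M] is closed under both operations.  The two maps form a Galois connection
    ([up_closure_subset]), hence [up_closure] preserves joins.  It preserves
    meets because [M] is closed under joins: if [x] lies above
    [a \in F] and [b \in G], it also lies above the join of [a] and [b], an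
    element of [M] that belongs to both filters ([up_closureI]).  Finally
    [trace (up_closure F) = F], which makes the embedding of part (1)
    injective.

    For part (2) take for [M] the Boolean center.  Its elements are exactly the
    fixed points of [x |-> x^Δ^∇] ([boolean_center_fixed]), so every filter of
    the center generates a normal filter of [L].  Conversely, a normal
    filter contains the whole normal chain of each of its elements; when this
    chain is finite, its last term is a fixed point, and so lies in the center
    ([finite_chain_center]).  A normal filter is thus generated by its trace on
    the center, and the two maps are mutually inverse. *)

Set Implicit Arguments.
Unset Strict Implicit.
Unset Printing Implicit Defensive.

Import Order.TTheory.
Local Open Scope classical_set_scope.
Local Open Scope order_scope.

(** * Lattice morphisms from Galois connections *)

Section LatticeMorphisms.
Context {d d' : Order.disp_t} {T : latticeType d} {T' : latticeType d'}.
Implicit Types (f : T -> T') (g : T' -> T).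

(** Monotonicity, a separate field of the structure of lattice morphisms, is
    forced by the preservation of meets. *)
Lemma lmorphism_of_meet_join f :
    {morph f : x y / x `&` y} -> {morph f : x y / x `|` y} ->
  exists h : {lmorphism T -> T'}, h = f :> (T -> T').
Proof.
move=> fI fU.
have f_homo : {homo f : x y / x <= y}.
  by move=> x y /meet_idPl xy; rewrite -xy fI leIr.
pose h : {lmorphism T -> T'} := HB.pack f
  (Order.isOrderMorphism.Build d T d' T' f f_homo)
  (Order.isMeetLatticeMorphism.Build d T d' T' f fI)
  (Order.isJoinLatticeMorphism.Build d T d' T' f fU).
by exists h.
Qed.

Lemma lower_adjointU f g :
    (forall x y, (f x <= y) = (x <= g y)) ->
  {morph f : x y / x `|` y}.
Proof.
move=> adj x y; apply/le_anti/andP; split.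
  by rewrite adj leUx -!adj leUl leUr.
have unit : x `|` y <= g (f (x `|` y)) by rewrite -adj.
by rewrite leUx !adj (le_trans (leUl x y)) // (le_trans (leUr y x)).
Qed.

Lemma upper_adjointI g f :
    (forall x y, (g y <= x) = (y <= f x)) ->
  {morph f : x y / x `&` y}.
Proof.
move=> adj x y; apply/le_anti/andP; split; last first.
  by rewrite -adj lexI !adj leIl leIr.
have counit : g (f (x `&` y)) <= x `&` y by rewrite adj.
by rewrite lexI -!adj (le_trans counit (leIl x y)) (le_trans counit (leIr y x)).
Qed.

(** An order isomorphism is both a lower and an upper adjoint of its inverse. *)
Lemma lmorphism_of_order_iso f g :
    {homo f : x y / x <= y} -> {homo g : x y / x <= y} ->
    cancel f g -> cancel g f ->
  exists h : {lmorphism T -> T'}, bijective h.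
Proof.
move=> f_homo g_homo fK gK.
have fg x y : (f x <= y) = (x <= g y).
  by apply/idP/idP => [/g_homo|/f_homo]; rewrite ?fK ?gK.
have gf x y : (g y <= x) = (y <= f x).
  by apply/idP/idP => [/f_homo|/g_homo]; rewrite ?fK ?gK.
have [h hE] := lmorphism_of_meet_join (upper_adjointI gf) (lower_adjointU fg).
by exists h; rewrite hE; exists g.
Qed.

End LatticeMorphisms.

(** * Normal chains *)

Section NormalStep.
Context {d : Order.disp_t} {L : wdlType d}.
Implicit Types x y : L.

Lemma normal_step_homo : {homo (fun x : L => x^Δ^∇) : x y / x <= y}.
Proof. by move=> x y xy; apply/wnabla_anti/wdelta_anti. Qed.

Lemma normal_step_le x : x^Δ^∇ <= x.
Proof. exact: le_trans (wnabla_le_wdelta _) (wdeltaK_le x). Qed.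

Lemma normal_chain_le x n : normal_chain x n <= x.
Proof. by elim: n => //= n; apply/le_trans/normal_step_le. Qed.

Lemma normal_filter_chain (F : set L) x n :
  is_normal_filter F -> F x -> F (normal_chain x n).
Proof. by move=> [_ nF] Fx; elim: n => //= n; apply: nF. Qed.

End NormalStep.

(** * Filters of a subalgebra and filters of the whole lattice *)

Section Subalgebra.
Context {d : Order.disp_t} {L : wdlType d} (M : subalgebra L).
Implicit Types (F : set M) (G : set L).

Definition up_closure F : set L := [set x | exists2 a : M, F a & val a <= x].

Definition trace G : set M := [set a : M | G (val a)].

Lemma up_closure_filter F : is_filter F -> is_filter (up_closure F).
Proof.
move=> [[a Fa] _ FI]; split.
- by exists (val a); exists a.
- by move=> x y [b Fb bx] xy; exists b; rewrite // (le_trans bx).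
- move=> x y [b Fb bx] [c Fc cy]; exists (b `&` c); first exact: FI.
  by rewrite subalg_meetE leI2.
Qed.

Lemma trace_filter G : is_filter G -> is_filter (trace G).
Proof.
move=> Gf; have [_ Gup GI] := Gf; split.
- by exists \top; exact: is_filter_top Gf.
- by move=> x y Gx xy; apply: Gup Gx xy.
- by move=> x y; apply: GI.
Qed.

Lemma up_closure_normal F : is_normal_filter F -> is_normal_filter (up_closure F).
Proof.
move=> [Ff Fn]; split; first exact: up_closure_filter.
move=> x [a Fa ax]; exists a^Δ^∇; first exact: Fn.
exact: (normal_step_homo ax).
Qed.

Lemma trace_normal G : is_normal_filter G -> is_normal_filter (trace G).
Proof.
by move=> [Gf Gn]; split; [exact: trace_filter | move=> x; apply: Gn].
Qed.

Lemma up_closureS F1 F2 : F1 `<=` F2 -> up_closure F1 `<=` up_closure F2.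
Proof. by move=> F12 x [a /F12 Fa ax]; exists a. Qed.

(** The Galois connection behind the preservation of joins: the join of normal
    filters, an intersection of normal filters, never has to be described by its
    elements. *)
Lemma up_closure_subset F G : is_filter G ->
  up_closure F `<=` G <-> F `<=` trace G.
Proof.
move=> [_ Gup _]; split=> FG; first by move=> a Fa; apply: FG; exists a.
by move=> x [a /FG Ga ax]; apply: Gup Ga ax.
Qed.

Lemma up_closureK F : is_filter F -> trace (up_closure F) = F.
Proof.
move=> [_ Fup _]; apply/seteqP; split=> [a [b Fb ba]|a Fa]; last by exists a.
exact: Fup Fb ba.
Qed.

(** A common upper bound of [a] in [F1] and [b] in [F2] lies above their join,
    which [M] contains and which is in both filters. *)
Lemma up_closureI F1 F2 : is_filter F1 -> is_filter F2 ->
  (up_closure F1 `&` up_closure F2)%classic = up_closure (F1 `&` F2)%classic.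
Proof.
move=> [_ up1 _] [_ up2 _]; apply/seteqP; split.
  move=> x [[a Fa ax] [b Fb bx]]; exists (a `|` b).
    by split; [apply: up1 Fa (leUl _ _) | apply: up2 Fb (leUr _ _)].
  by rewrite subalg_joinE leUx ax bx.
by move=> x [a [F1a F2a] ax]; split; exists a.
Qed.

End Subalgebra.

(** * Lattices of filters *)

Section FilterLattices.
Context {d : Order.disp_t}.

Lemma lfilterW (K : tbLatticeType d) (F : lfilter K) :
  is_filter (lfilter_set F).
Proof. exact/asboolP/lfilterP. Qed.

Lemma nfilterW (K : wdlType d) (F : nfilter K) :
  is_normal_filter (nfilter_set F).
Proof. exact/asboolP/nfilterP. Qed.

Context {L : wdlType d} (M : subalgebra L).

Definition nfilter_up (F : nfilter M) : nfilter L :=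
  NFilter (asboolT (up_closure_normal (nfilterW F))).

Definition nfilter_trace (G : nfilter L) : nfilter M :=
  NFilter (asboolT (trace_normal M (nfilterW G))).

Lemma nfilter_up_adjoint (F : nfilter M) (G : nfilter L) :
  (nfilter_up F <= G) = (F <= nfilter_trace G).
Proof.
rewrite !nfilter_leP; apply: asbool_equiv_eq.
exact: up_closure_subset (nfilterW G).1.
Qed.

Lemma nfilter_upI : {morph nfilter_up : F G / F `&` G}.
Proof.
move=> F G; apply/val_inj/esym/up_closureI.
- exact: (nfilterW F).1.
- exact: (nfilterW G).1.
Qed.

Lemma nfilter_upK : cancel nfilter_up nfilter_trace.
Proof. by move=> F; apply/val_inj/up_closureK/(nfilterW F).1. Qed.

Lemma nfilter_subalgebra_embedding :
  exists f : {lmorphism nfilter M -> nfilter L}, injective f.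
Proof.
have [f fE] :=
  lmorphism_of_meet_join nfilter_upI (lower_adjointU nfilter_up_adjoint).
by exists f; rewrite fE; exact: can_inj nfilter_upK.
Qed.

End FilterLattices.

(** * The Boolean center and finite normal chains *)

Section Center.
Context {d : Order.disp_t} {L : wdlType d}.
Local Notation B := (boolean_center L).

(** A fixed point [x] satisfies [x^Δ <= x^Δ^∇^∇ = x^∇], while [x^∇ <= x^Δ]
    always holds. *)
Lemma boolean_center_fixed (x : L) : boolean_center_set x <-> x^Δ^∇ = x.
Proof.
split=> [xB|xE]; apply/le_anti.
  by rewrite normal_step_le xB wnablaK_ge.
by rewrite wnabla_le_wdelta andbT -[in leRHS]xE wnablaK_ge.
Qed.

Lemma finite_chain_center (x : L) : finite_normal_chain x ->
  exists n, boolean_center_set (normal_chain x n).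
Proof. by move=> [n [_ xn]]; exists n; apply/boolean_center_fixed. Qed.

(** Every filter of the center is normal, since [x |-> x^Δ^∇] is the identity
    there. *)
Lemma up_closure_center_normal (F : set B) :
  is_filter F -> is_normal_filter (up_closure F).
Proof.
move=> Ff; apply: up_closure_normal; split=> // b Fb.
suff -> : b^Δ^∇ = b by [].
exact/val_inj/boolean_center_fixed/set_mem/(valP b).
Qed.

(** Below each [x] in [G] lies the last term of its normal chain, an element of
    [G] in the center. *)
Lemma trace_centerK (G : set L) : (forall a : L, finite_normal_chain a) ->
  is_normal_filter G -> up_closure (trace (M := B) G) = G.
Proof.
move=> fin Gn; apply/seteqP; split.
  by apply/up_closure_subset => //; exact: Gn.1.
move=> x Gx; have [n /mem_set xnB] := finite_chain_center (fin x).
exists (exist (fun z => z \in subalg_set B) _ xnB).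
  exact: normal_filter_chain.
exact: normal_chain_le.
Qed.

Definition center_up (F : lfilter B) : nfilter L :=
  NFilter (asboolT (up_closure_center_normal (lfilterW F))).

Definition center_trace (G : nfilter L) : lfilter B :=
  LFilter (asboolT (trace_filter B (nfilterW G).1)).

Lemma nfilter_center_iso : (forall a : L, finite_normal_chain a) ->
  exists f : {lmorphism nfilter L -> lfilter B}, bijective f.
Proof.
move=> fin; apply: (@lmorphism_of_order_iso _ _ _ _ center_trace center_up).
- move=> F G; rewrite nfilter_leP lfilter_leP => /asboolP FG.
  by apply/asboolP => x; apply: FG.
- move=> F G; rewrite nfilter_leP lfilter_leP => /asboolP FG.
  by apply/asboolP/up_closureS.
- by move=> G; apply/val_inj/trace_centerK/nfilterW.
- by move=> F; apply/val_inj/up_closureK/lfilterW.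
Qed.

End Center.

Theorem theorem11 (d : Order.disp_t) (L : wdlType d) :
  (forall M : subalgebra L,
     exists f : {lmorphism nfilter M -> nfilter L}, injective f) /\
  ((forall a : L, finite_normal_chain a) ->
     exists f : {lmorphism nfilter L -> lfilter (boolean_center L)},
       bijective f).
Proof.
split; [exact: nfilter_subalgebra_embedding | exact: nfilter_center_iso].
Qed.
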